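(* Let $X\sim L(n)$ and $\mu=\mu(n)=\frac{n-\log n+\log\ln n}{2}$, where $\log$ is base $2$ and $\ln$ is the natural logarithm. For all sufficiently large $n$, \[ 2^{-(x+1)^2-1}\le \mathbb{P}(|X-\mu|\ge x)\le 2^{-(x-2)^2+2}+n^{-n} \] for each $x>1$.
   Context: $B_m$ denotes the $m$-th Bell number. For $0\le k\le n$ let $\ell_{n,k}=\binom{n}{k}2^{k(n-k)}B_{n-k}$ and $\mathscr{L}_n=\sum_{k=0}^n\ell_{n,k}$. $L(n)$ is the integer-valued distribution with $\mathbb{P}(X=x)=\ell_{n,x}/\mathscr{L}_n$ for $x=0,\dots,n$.
   Formalization: The lower bound is asserted only for 1 < x ≤ n − μ: for larger x the event |X − μ| ≥ x is null, as X lies in {0,…,n}, so the stated positive lower bound fails there; the upper bound is for every x > 1. *)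

(* Defs.v *)
From HB Require Import structures.
From mathcomp Require Import all_boot all_order all_algebra.
From mathcomp Require Import all_classical all_reals all_analysis.

Set Implicit Arguments.
Unset Strict Implicit.
Unset Printing Implicit Defensive.

Import Order.TTheory GRing.Theory Num.Theory.
Import numFieldNormedType.Exports.

Local Open Scope classical_set_scope.
Local Open Scope ring_scope.

(* Bell number: the number of set partitions of an m-element set. *)
Definition bell (m : nat) : nat :=
  #|[set Q : {set {set 'I_m}} | finset.partition Q [set: 'I_m]%SET]%SET|.

Definition ell (n k : nat) : nat :=
  ('C(n, k) * 2 ^ (k * (n - k)) * bell (n - k))%N.

Definition scrL (n : nat) : nat := (\sum_(0 <= k < n.+1) ell n k)%N.

(* X ~ L(n).  Only the masses at 0, ..., n are prescribed; since they add up
   to 1, they determine the law of X. *)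
Definition has_law_L (d : measure_display) (T : measurableType d)
    (R : realType) (P : probability T R) (X : {RV P >-> R}) (n : nat) : Prop :=
  forall k : nat, (k <= n)%N -> pmf X k%:R = (ell n k)%:R / (scrL n)%:R.

Definition log2 (R : realType) (x : R) : R := ln x / ln 2.

Definition mu (R : realType) (n : nat) : R :=
  (n%:R - log2 n%:R + log2 (ln n%:R)) / 2.

(* Main.v *)
Require Import Defs.
From HB Require Import structures.
From mathcomp Require Import all_boot all_order all_algebra.
From mathcomp Require Import all_classical all_reals all_analysis.
From mathcomp Require Import measurable_realfun ring lra zify.

Set Implicit Arguments.
Unset Strict Implicit.
Unset Printing Implicit Defensive.

Import Order.TTheory GRing.Theory Num.Theory.
Import numFieldNormedType.Exports.

Local Open Scope classical_set_scope.
Local Open Scope ring_scope.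

(* By Dobinski's formula, [B_m] is the total mass of the weights
   [N ^ m / (e N!)], and [B_(m+1) / B_m] is their mean.  At each step these
   weights at least double below, and at least halve above, a window of relative
   width o(1) around [m / ln m], so [B_(m+1) / B_m] is asymptotic to [m / ln m].  Hence
   [ell n (k+1) / ell n k] is [2 ^ (2 (mu - k))] times a factor [f_k] that is
   close to 1 when [k] is close to [n / 2], i.e. [ell n k] is a Gaussian
   centred at [mu + 1/2] times a slowly varying profile with ratios [f_k].
   The shift by 1/2 and the constants of the theorem leave room for [f_k] to
   lie between 4/5 and 5/4 on the relevant sides of [mu].  Only the lower bound
   at a distance of order [n] needs more: there [f_k] may drop to about 1/2, but
   the product of all the factors still beats [2 ^ - (k - mu)] by an
   exponential margin. *)

(** * Dobinski's formula *)

Lemma preim_partition_eqP (T rT : finType) (f : T -> rT) (Q : {set {set T}}) :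
  finset.partition Q [set: T]%SET ->
  (preim_partition f [set: T]%SET = Q) <->
  (forall x y, (f x == f y) = (y \in finset.pblock Q x)).
Proof.
move=> pQ; split=> [<- x y|fQ].
  have E : {in [set: T]%SET & &, equivalence_rel (fun x y => f x == f y)}.
    by split=> // /eqP->.
  by rewrite (pblock_equivalence_partition E) ?finset.inE.
rewrite -(equivalence_partition_pblock pQ).
apply: finset.eq_imset => x; apply/finset.setP => y; by rewrite !finset.inE fQ.
Qed.

(** Functions with kernel [Q] correspond to injections from the blocks of [Q] to [rT]. [F] is this
    bijection; its inverse evaluates at a chosen representative of each block. *)
Lemma card_preim_partition (T rT : finType) (Q : {set {set T}}) :
  finset.partition Q [set: T]%SET ->
  #|[set f : {ffun T -> rT} | preim_partition f [set: T]%SET == Q]%SET|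
    = (#|rT| ^_ #|Q|)%N.
Proof.
move=> pQ; have /and3P[/eqP covQ tiQ Q0] := pQ.
have pbQ x : finset.pblock Q x \in Q by rewrite pblock_mem // covQ finset.inE.
pose D := {B : {set T} | B \in Q}.
pose F (g : {ffun D -> rT}) :=
  [ffun x : T => g (exist _ (finset.pblock Q x) (pbQ x))].
have reprP (B : D) : exists x, x \in val B.
  by apply/finset.set0Pn; apply: contraNneq Q0 => <-; exact: (valP B).
have reprK (B : D) :
    exist (fun A => is_true (A \in Q))
      (finset.pblock Q (xchoose (reprP B))) (pbQ _) = B :> D.
  by apply: val_inj => /=; apply: def_pblock (valP B) (xchooseP (reprP B)).
have Finj : injective F.
  move=> g h gh; apply/ffunP => B.
  by move/ffunP/(_ (xchoose (reprP B))): gh; rewrite !ffunE reprK.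
have -> : #|Q| = #|{: D}| by rewrite card_sig; apply: eq_card.
rewrite -card_inj_ffuns -(card_imset _ Finj); apply: eq_card => f.
rewrite finset.inE; apply/eqP/imsetP => [fQ|[g]].
  have {}fQ := (preim_partition_eqP f pQ).1 fQ.
  have fE (x : T) (B : D) : x \in val B -> f x = f (xchoose (reprP B)).
    move=> xB; apply/eqP; rewrite fQ (def_pblock tiQ (valP B) xB).
    exact: xchooseP.
  exists [ffun B => f (xchoose (reprP B))]; last first.
    apply/ffunP => x; rewrite !ffunE; apply: fE.
    by rewrite /= mem_pblock covQ finset.inE.
  rewrite finset.inE; apply/injectiveP => B C; rewrite !ffunE => /eqP.
  rewrite fQ => BC; rewrite -(reprK B) -(reprK C); apply: val_inj => /=.
  by rewrite -(same_pblock tiQ BC).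
rewrite finset.inE => /injectiveP ginj ->; apply/(preim_partition_eqP _ pQ) => x y.
rewrite !ffunE (inj_eq ginj) -eq_pblock // ?covQ ?finset.inE //.
Qed.

(** Sort the maps from an [m]-set to an [N]-set by their kernel. *)
Lemma expn_sum_ffact (m N : nat) :
  (N ^ m)%N = (\sum_(Q : {set {set 'I_m}} | finset.partition Q [set: 'I_m]%SET)
                 N ^_ #|Q|)%N.
Proof.
transitivity #|{: {ffun 'I_m -> 'I_N}}|; first by rewrite card_ffun !card_ord.
rewrite -sum1_card.
rewrite (partition_big (fun f : {ffun 'I_m -> 'I_N} =>
   preim_partition f [set: 'I_m]%SET)
  (fun Q => finset.partition Q [set: 'I_m]%SET)) /=; last first.
  by move=> f _; exact: preim_partitionP.
apply: eq_bigr => Q pQ; have := card_preim_partition 'I_N pQ.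
by rewrite card_ord => <-; rewrite -sum1dep_card.
Qed.

Definition dobinski_sum (R : realType) (m M : nat) : R :=
  \sum_(0 <= N < M) (N ^ m)%:R / N`!%:R.

(** For [N >= j] the term is [1 / (N - j)!] and the earlier terms vanish, so this is the exponential
    series shifted by [j]. *)
Lemma cvg_sum_ffact (R : realType) (j : nat) :
  (\sum_(0 <= N < M) (N ^_ j)%:R / N`!%:R : R) @[M --> \oo] --> (expR 1 : R).
Proof.
rewrite -(cvg_shiftn j) /=.
have -> : (fun M => \sum_(0 <= N < M + j) (N ^_ j)%:R / N`!%:R : R)
  = series (exp_coeff (1 : R)).
  apply/funext => M; rewrite /series /= addnC (big_cat_nat (n := j)) ?leq_addr //=.
  rewrite big_nat_cond big1 ?add0r; last first.
    by move=> i /andP[/andP[_ ij] _]; rewrite ffact_small // mul0r.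
  rewrite -{1}[j]add0n big_addn addKn; apply: eq_bigr => i _.
  rewrite /exp_coeff /= expr1n.
  have /(congr1 (fun n : nat => n%:R : R)) := ffact_fact (leq_addl i j).
  rewrite natrM addnK => <-.
  rewrite invfM mulrA divff ?mul1r ?pnatr_eq0 -?lt0n ?ffact_gt0 ?leq_addl //.
exact: is_cvg_series_exp_coeff.
Qed.

(** After [expn_sum_ffact] and an exchange of sums, each of the [bell m] partitions contributes
    [e]. *)
Lemma cvg_dobinski_sum (R : realType) (m : nat) :
  dobinski_sum R m M @[M --> \oo] --> (expR 1 * (bell m)%:R : R).
Proof.
have -> : dobinski_sum R m = (fun M => \sum_(Q : {set {set 'I_m}} |
    finset.partition Q [set: 'I_m]%SET)
    (\sum_(0 <= N < M) (N ^_ #|Q|)%:R / N`!%:R)).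
  apply/funext => M; rewrite exchange_big /=; apply: eq_bigr => N _.
  by rewrite (expn_sum_ffact m N) natr_sum mulr_suml.
have -> : expR 1 * (bell m)%:R = \sum_(Q : {set {set 'I_m}} |
    finset.partition Q [set: 'I_m]%SET) (expR 1 : R).
  rewrite sumr_const mulr_natr; congr (_ *+ _); rewrite /bell.
  by apply: eq_card => Q; rewrite finset.inE.
apply: cvg_big => [|Q _]; last exact: cvg_sum_ffact.
exact: add_continuous.
Qed.

Lemma dobinski_sumS (R : realType) (m M : nat) :
  dobinski_sum R m.+1 M = \sum_(0 <= N < M) N%:R * ((N ^ m)%:R / N`!%:R).
Proof. by apply: eq_bigr => N _; rewrite expnS natrM mulrA. Qed.

Lemma bell_gt0 (m : nat) : (0 < bell m)%N.
Proof.
apply/card_gt0P; exists (preim_partition id [set: 'I_m]%SET).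
by rewrite finset.inE preim_partitionP.
Qed.

Lemma bell0 : bell 0 = 1%N.
Proof.
have I0 : [set: 'I_0]%SET = finset.set0 by apply/finset.setP => -[].
apply/eqP/cards1P; exists finset.set0; apply/finset.setP => Q.
by rewrite !finset.inE I0 partition_set0.
Qed.

(** * Ratios of consecutive Bell numbers *)

Lemma mean_le_halving (R : realDomainType) (w : nat -> R) (K M : nat) :
  (forall N, 0 <= w N) -> (forall N, (K <= N)%N -> 2 * w N.+1 <= w N) ->
  \sum_(0 <= N < M) N%:R * w N <= (K + 2)%:R * \sum_(0 <= N < M) w N.
Proof.
move=> w0 wK; rewrite -subr_ge0 mulr_sumr -sumrB.
have [MK|KM] := leqP M K.
  rewrite big_nat_cond sumr_ge0// => N /andP[/andP[_ NM] _].
  by rewrite -mulrBl mulr_ge0// subr_ge0 ler_nat; lia.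
(* Strengthened for the induction on [M]: by halving, this reserve pays for the next term
   [(K + 2 - M) * w M], which is negative or zero once [M > K + 2]. *)
suff : (M%:R - K%:R + 1) * w M.-1 <=
    \sum_(0 <= N < M) ((K + 2)%:R * w N - N%:R * w N).
  apply: le_trans; rewrite mulr_ge0//.
  have : K%:R <= M%:R :> R by rewrite ler_nat ltnW.
  by lra.
elim: M KM => // M IH; rewrite ltnS leq_eqVlt => /predU1P[<-|KM] /=.
  rewrite big_nat_recr//=.
  have : 0 <= \sum_(0 <= N < K) ((K + 2)%:R * w N - N%:R * w N).
    rewrite big_nat_cond sumr_ge0// => N /andP[/andP[_ NM] _].
    by rewrite -mulrBl mulr_ge0// subr_ge0 ler_nat; lia.
  by rewrite natrD -natr1; have := w0 K; nra.
rewrite big_nat_recr//=; have := IH KM.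
have := wK M.-1; rewrite prednK ?(leq_ltn_trans _ KM)//.
have -> : (K <= M.-1)%N by lia.
move=> /(_ isT); rewrite natrD -natr1.
have : K%:R + 1 <= M%:R :> R by rewrite natr1 ler_nat.
have := w0 M; have := w0 M.-1.
set S := bigop.body _ _ _; set a := w M; set b := w _.
by move: S a b => S a b; nra.
Qed.

(** Doubling bounds the sum up to [P] by [2 * w P] ([T]), and hence also the sum of [(P - N) * w N]
    ([U]). Up to [K], the loss in [U] is covered by twice the sum of the weights, at least
    [2 * w K]; beyond [K] every term is nonnegative. *)
Lemma mean_ge_doubling (R : realDomainType) (w : nat -> R) (K M : nat) :
  (forall N, 0 <= w N) -> (forall N, (N < K)%N -> 2 * w N <= w N.+1) ->
  (K < M)%N ->
  (K%:R - 2) * \sum_(0 <= N < M) w N <= \sum_(0 <= N < M) N%:R * w N.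
Proof.
move=> w0 wK KM.
have T P : (P <= K)%N -> \sum_(0 <= N < P.+1) w N <= 2 * w P.
  elim: P => [_|P IH PK]; first by rewrite big_nat1; have := w0 0%N; lra.
  by rewrite big_nat_recr//=; have := IH (ltnW PK); have := wK _ PK; lra.
have U P : (P <= K)%N ->
    \sum_(0 <= N < P.+1) (P%:R * w N - N%:R * w N) <= 2 * w P.
  elim: P => [_|P IH PK]; first by rewrite big_nat1; have := w0 0%N; lra.
  rewrite big_nat_recr//= subrr addr0.
  under eq_bigr do rewrite -natr1 mulrDl mul1r addrAC.
  rewrite big_split/=.
  by have := IH (ltnW PK); have := T _ (ltnW PK); have := wK _ PK; lra.
rewrite -subr_ge0 mulr_sumr -sumrB (big_cat_nat (n := K.+1))//=.
apply: addr_ge0.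
  have -> : \sum_(0 <= N < K.+1) (N%:R * w N - (K%:R - 2) * w N) =
    2 * \sum_(0 <= N < K.+1) w N -
     \sum_(0 <= N < K.+1) (K%:R * w N - N%:R * w N).
    by rewrite mulr_sumr -sumrB; apply: eq_bigr => N _; ring.
  have : w K <= \sum_(0 <= N < K.+1) w N.
    by rewrite big_nat_recr//= lerDr sumr_ge0.
  by have := U _ (leqnn K); lra.
rewrite big_nat_cond sumr_ge0// => N /andP[/andP[KN _] _].
rewrite -mulrBl mulr_ge0//.
have : K%:R <= N%:R :> R by rewrite ler_nat ltnW.
by lra.
Qed.

Lemma ler_bell_dobinski (R : realType) (a b : R) (p q : nat) :
  (\forall M \near \oo, a * dobinski_sum R p M <= b * dobinski_sum R q M) ->
  a * (bell p)%:R <= b * (bell q)%:R.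
Proof.
move=> ab; rewrite -(ler_pM2l (expR_gt0 (1 : R))) !(mulrCA (expR 1)).
by apply: ler_cvg_to ab; apply: cvgMr; exact: cvg_dobinski_sum.
Qed.

Lemma ler_bellS (R : realType) (m : nat) : (bell m)%:R <= (bell m.+1)%:R :> R.
Proof.
(* The case [m = 0] is separate because [0 ^ 0] exceeds [0 ^ 1]. *)
case: m => [|m]; first by rewrite bell0 ler_nat bell_gt0.
rewrite -[leLHS]mul1r -[leRHS]mul1r; apply: ler_bell_dobinski.
apply: nearW => M; rewrite !mul1r; apply: ler_sum => N _.
rewrite ler_wpM2r// ler_nat; case: N => [|N]; first by rewrite !exp0n.
by rewrite leq_pexp2l.
Qed.

(** The ratio of the weights [N ^ m / N!] at [N + 1] and [N] is [(1 + 1 / N) ^ m / (N + 1)]. From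
    [K] on it is at most [expR (m / K) / (K + 1)], hence at most 1/2. *)
Lemma bellS_ub (R : realType) (m K : nat) : (0 < K)%N ->
  2 * expR (m%:R / K%:R) <= K%:R + 1 :> R ->
  (bell m.+1)%:R <= (K + 2)%:R * (bell m)%:R :> R.
Proof.
move=> K0 eK; rewrite -[leLHS]mul1r; apply: ler_bell_dobinski.
apply: nearW => M; rewrite mul1r dobinski_sumS.
apply: mean_le_halving => N //= KN.
have N0 : 0 < N%:R :> R by rewrite ltr0n (leq_trans K0).
rewrite factS natrM invfM !mulrA ler_pM2r ?invr_gt0 ?ltr0n ?fact_gt0//.
rewrite ler_pdivrMr ?ltr0n// !natrX.
have -> : N.+1%:R = N%:R * (1 + N%:R^-1) :> R.
  by rewrite mulrDr divff ?lt0r_neq0// mulr1 natr1.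
rewrite exprMn mulrCA ler_pM2l ?exprn_gt0//.
apply: le_trans (_ : 2 * expR (m%:R / N%:R) <= _).
  rewrite ler_pM2l// expRM_natl lerXn2r// ?nnegrE ?expR_ge0 ?addr_ge0 ?invr_ge0 ?ler0n//.
  exact: expR_ge1Dx.
have KN' : K%:R <= N%:R :> R by rewrite ler_nat.
apply: (le_trans (y := 2 * expR (m%:R / K%:R))).
  rewrite ler_pM2l// ler_expR ler_wpM2l// lef_pV2// posrE// ltr0n//.
rewrite mulrDr divff ?lt0r_neq0// mulr1; lra.
Qed.

(** The weight at [N - 1] divided by the weight at [N <= K] is [N * (1 - 1 / N) ^ m], at most
    [K * expR (- m / K)], hence at most 1/2. *)
Lemma bellS_lb (R : realType) (m K : nat) : (0 < m)%N -> (0 < K)%N ->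
  2 * K%:R <= expR (m%:R / K%:R) :> R ->
  (K%:R - 2) * (bell m)%:R <= (bell m.+1)%:R :> R.
Proof.
move=> m0 K0 eK; rewrite -[leRHS]mul1r; apply: ler_bell_dobinski.
exists K.+1 => // M /= KM; rewrite mul1r dobinski_sumS.
apply: mean_ge_doubling => // N NK.
(* As [0 < m], the weight at 0 vanishes. *)
case: N NK => [|N NK]; first by rewrite exp0n// mul0r mulr0.
have N0 : 0 < N.+1%:R :> R by [].
rewrite [N.+2`!]factS natrM invfM !mulrA ler_pM2r ?invr_gt0 ?ltr0n ?fact_gt0//.
rewrite ler_pdivlMr ?ltr0n// !natrX.
have -> : N.+1%:R = N.+2%:R * (1 - N.+2%:R^-1) :> R.
  rewrite mulrBr divff ?lt0r_neq0// ?mulr1 ?ltr0n// -[in RHS]natr1 addrK//.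
rewrite exprMn mulrCA -mulrA -[leRHS]mulr1 ler_pM2l ?exprn_gt0 ?ltr0n//.
have q0 : 0 <= 1 - N.+2%:R^-1 :> R.
  by rewrite subr_ge0 invf_le1 ?ltr0n// ler1n.
have q1 : (1 - N.+2%:R^-1) ^+ m <= expR (- (m%:R / N.+2%:R)) :> R.
  rewrite -mulrN expRM_natl lerXn2r// ?nnegrE ?expR_ge0//.
  exact: expR_ge1Dx.
rewrite mulrAC; apply: (le_trans (ler_wpM2l _ q1)) => //.
rewrite expRN ler_pdivrMr ?expR_gt0// mul1r.
have KN' : N.+2%:R <= K%:R :> R by rewrite ler_nat.
apply: (le_trans (y := expR (m%:R / K%:R))).
  apply: le_trans eK; lra.
by rewrite ler_expR ler_wpM2l// lef_pV2// posrE// ltr0n.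
Qed.

(* Every requirement on [n] below follows from this one for [L = ln n]. *)
Definition large (R : realType) (L : R) : Prop :=
  1000 <= L /\ 1000 * L ^+ 2 <= expR (L / 1000).

(** The cubic term of the exponential series suffices: [(L / a) ^ 3 / 6 >= a * L ^ 2] as soon as
    [L >= 6 * a ^ 4]. *)
Lemma sqr_le_expR (R : realType) (a L : R) : 1 <= a -> 6 * a ^+ 4 <= L ->
  a <= L /\ a * L ^+ 2 <= expR (L / a).
Proof.
move=> a1 LL.
have a0 : 0 < a by exact: lt_le_trans a1.
have a4 : a <= 6 * a ^+ 4.
  by have := @ler_weXn2l R a a1 1 4 isT; rewrite expr1; lra.
have L1 := le_trans a4 LL.
split => //.
have L0 : 0 <= L / a by rewrite divr_ge0// ltW// (lt_le_trans a0).
apply: le_trans (expR_ge1Dxn 2 L0).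
rewrite [3`!](_ : _ = 6%N)//.
rewrite -[leLHS]add0r lerD// expr_div_n ler_pdivlMr// ler_pdivlMr ?exprn_gt0//.
rewrite [L ^+ 3]exprS.
have -> : a * L ^+ 2 * 6 * a ^+ 3 = 6 * a ^+ 4 * L ^+ 2 by ring.
by rewrite ler_wpM2r// sqr_ge0.
Qed.

Lemma large_ln (R : realType) : \forall n \near \oo, large (ln n%:R : R).
Proof.
near=> n.
have nL : expR (6 * 1000 ^+ 4) <= n%:R :> R by near: n; exact: nbhs_infty_ger.
have n0 : 0 < n%:R :> R by exact: lt_le_trans (expR_gt0 _) nL.
by apply: sqr_le_expR; [lra|rewrite -ler_expR lnK].
Unshelve. all: by end_near. Qed.

Section LargeParameter.
Variables (R : realType) (n : nat).
Hypothesis Ln : large (ln n%:R : R).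
Let L : R := ln n%:R.

Lemma large_n_gt0 : 0 < n%:R :> R.
Proof.
have [n0|//] := leP n%:R (0 : R).
by have [+ _] := Ln; rewrite ln0//; lra.
Qed.

Lemma large_expR : expR L = n%:R.
Proof. by rewrite lnK// posrE large_n_gt0. Qed.

Lemma large_sqr (c : R) : 1000^-1 <= c -> 1000 * L ^+ 2 <= expR (c * L).
Proof.
move=> c1; apply: (le_trans Ln.2); rewrite ler_expR mulrC ler_wpM2r//.
by have := Ln.1; lra.
Qed.

Lemma large_n : 1000 * L ^+ 2 <= n%:R.
Proof. by have := @large_sqr 1; rewrite mul1r large_expR; apply; lra. Qed.

(** Apply [bellS_ub] with [K] just above [41/40 * s], where [s = (m + 1) / L]. Then
    [expR (m / K) <= n ^ (40/41)], which is negligible against [s >= n / L ^ 2]. *)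
Lemma bell_ratio_ub (m : nat) :
  n%:R / L <= m.+1%:R -> (m.+1 <= n)%N ->
  (bell m.+1)%:R <= 21 / 20 * (m.+1%:R / L) * (bell m)%:R :> R.
Proof.
move=> nLm mn; have L1 := Ln.1; rewrite -/L in L1.
have L0 : 0 < L by lra.
set s := m.+1%:R / L.
have s1 : n%:R / L ^+ 2 <= s by rewrite expr2 invfM mulrA ler_pM2r ?invr_gt0.
have s2 : 1000 <= s.
  by apply: le_trans s1; rewrite ler_pdivlMr ?exprn_gt0// large_n.
pose K := (Num.truncn (41 / 40 * s)).+1.
have /andP[K1 K2] : (Num.truncn (41 / 40 * s))%:R <= 41 / 40 * s < K%:R.
  by apply: Num.Theory.truncn_itv; lra.
have K3 : K%:R <= 41 / 40 * s + 1 by rewrite /K -natr1; lra.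
apply: (le_trans (@bellS_ub R m K isT _)).
  have e1 : m%:R / K%:R <= 40 / 41 * L.
    rewrite ler_pdivrMr//.
    have -> : m%:R = m.+1%:R - 1 :> R by rewrite -natr1 addrK.
    have -> : m.+1%:R = s * L by rewrite /s divfK// lt0r_neq0.
    by nra.
  have e2 : expR (40 / 41 * L) * (1000 * L ^+ 2) <= n%:R.
    rewrite -large_expR.
    have -> : expR L = expR (40 / 41 * L) * expR (1 / 41 * L).
      by rewrite -expRD; congr expR; lra.
    by rewrite ler_pM2l ?expR_gt0// large_sqr//; lra.
  have e3 : 1000 * expR (40 / 41 * L) <= s.
    apply: le_trans s1; rewrite ler_pdivlMr ?exprn_gt0//.
    by rewrite mulrAC mulrC.
  have e4 : expR (m%:R / K%:R) <= expR (40 / 41 * L) by rewrite ler_expR.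
  have := expR_gt0 (40 / 41 * L); lra.
rewrite ler_wpM2r// natrD; lra.
Qed.

(** For large [s = (m + 1) / L], let [K] be the integer part of [19/20 * m / L]: then
    [expR (m / K) >= n ^ (20/19)], which exceeds [2 * n]. Small [s] are treated apart, so that all
    [m < n] are covered. *)
Lemma bell_ratio_lb (m : nat) : (m.+1 <= n)%N ->
  9 / 10 * (m.+1%:R / L) * (bell m)%:R <= (bell m.+1)%:R :> R.
Proof.
move=> mn; have L1 := Ln.1; rewrite -/L in L1.
have L0 : 0 < L by lra.
set s := m.+1%:R / L.
have sL : m.+1%:R = s * L by rewrite /s divfK// lt0r_neq0.
have mL : m%:R = s * L - 1 by rewrite -sL -natr1 addrK.
have [s1|s1] := leP s 1.
  apply: le_trans (ler_bellS R m).
  by rewrite -[leRHS]mul1r ler_wpM2r//; lra.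
have m0 : (0 < m)%N.
  by rewrite -(ltr_nat R) mL; nra.
have L2 : 1000 <= L ^+ 2 by nra.
(* For moderate [s] the fixed [K = 80] works: [K - 2 >= 9/10 * 80], and [m / 80 >= L / 1000] makes
   the exponential large. *)
have [s2|s2] := leP s 80.
  apply: (le_trans _ (@bellS_lb R m 80 m0 isT _)).
    by rewrite ler_wpM2r//; lra.
  have e1 : 1 / 1000 * L <= m%:R / 80 by rewrite mL; nra.
  have := @large_sqr (1 / 1000).
  have : expR (1 / 1000 * L) <= expR (m%:R / 80) by rewrite ler_expR.
  by move=> + /(_ ltac:(lra)); lra.
pose y := 19 / 20 * (m%:R / L).
have yE : y = 19 / 20 * s - 19 / 20 / L.
  by rewrite /y mL mulrBl mulfK ?lt0r_neq0//; lra.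
have iL : L^-1 <= 1 / 1000.
  by rewrite -[leLHS]mul1r ler_pdivrMr//; lra.
have iL0 : 0 < L^-1 by rewrite invr_gt0.
have y1 : 9 / 10 * s + 3 <= y by rewrite yE; lra.
pose K := Num.truncn y.
have /andP[K1 K2] : K%:R <= y < K.+1%:R by apply: Num.Theory.truncn_itv; lra.
rewrite -natr1 in K2.
have K0 : (0 < K)%N by rewrite -(ltr_nat R); lra.
apply: (le_trans _ (@bellS_lb R m K m0 K0 _)).
  by rewrite ler_wpM2r//; lra.
have e1 : 20 / 19 * L <= m%:R / K%:R.
  rewrite ler_pdivlMr ?ltr0n//.
  have : 20 / 19 * L * y = m%:R by rewrite /y; field; rewrite lt0r_neq0.
  by move=> <-; rewrite ler_wpM2l//; lra.
apply: (le_trans (y := expR (20 / 19 * L))); last by rewrite ler_expR.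
have -> : expR (20 / 19 * L) = expR L * expR (1 / 19 * L).
  by rewrite -expRD; congr expR; lra.
have e2 : 2 <= expR (1 / 19 * L).
  by have := @large_sqr (1 / 19); move=> /(_ ltac:(lra)); lra.
have mnR : m.+1%:R <= n%:R :> R by rewrite ler_nat.
rewrite large_expR.
have : K%:R <= n%:R :> R.
  by apply: (le_trans K1); rewrite yE; nra.
by nra.
Qed.

End LargeParameter.

Lemma ln2_ge (R : realType) : 1 / 2 <= ln 2 :> R.
Proof.
rewrite -ler_expR lnK ?posrE//.
have := expRxMexpNx_1 (1 / 2 : R); have := expR_ge1Dx (- (1 / 2) : R).
by have := expR_gt0 (1 / 2 : R); nra.
Qed.

(** Serves where [m] is too small for [bell_ratio_ub]. With [K = m + 8], [2 * expR (m / K)] is at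
    most [2 * e <= 8]. *)
Lemma bell_ratio_crude (R : realType) (m : nat) :
  (bell m.+1)%:R <= 10 * m.+1%:R * (bell m)%:R :> R.
Proof.
have e4 : expR 1 <= 4 :> R.
  have := @ln2_ge R; rewrite -ler_expR lnK ?posrE//.
  have -> : expR 1 = expR (1 / 2) * expR (1 / 2) :> R.
    by rewrite -expRD; congr expR; lra.
  by have := expR_gt0 (1 / 2 : R); nra.
apply: (le_trans (@bellS_ub R m (m + 8) _ _)); first by rewrite addnS.
- have : expR (m%:R / (m + 8)%:R) <= expR 1 :> R.
    by rewrite ler_expR ler_pdivrMr ?mul1r ?ler_nat ?leq_addr.
  by rewrite natrD; have := ler0n R m; lra.
- by rewrite ler_wpM2r// -addnA natrD -natr1; have := ler0n R m; lra.
Qed.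

(** * The Gaussian profile *)

Lemma pow2D (R : realType) (a b : R) : 2 `^ (a + b) = 2 `^ a * 2 `^ b.
Proof. by rewrite powRD// pnatr_eq0 implybT. Qed.

Lemma pow2_gt0 (R : realType) (a : R) : 0 < 2 `^ a.
Proof. by rewrite powR_gt0. Qed.

Lemma ler_pow2 (R : realType) (a b : R) : a <= b -> 2 `^ a <= 2 `^ b.
Proof. by apply: ler_powR; rewrite ler1n. Qed.

Lemma pow2_log2 (R : realType) (x : R) : 0 < x -> 2 `^ (log2 x) = x.
Proof.
move=> x0; rewrite /powR pnatr_eq0/= /log2 divfK ?lnK ?posrE//.
by rewrite gt_eqF// (lt_le_trans _ (ln2_ge R)).
Qed.

(** Division-free ratio of consecutive [ell]: with [n = k + m + 1], [(k + 1) * C(n, k + 1) = (n - k)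
    * C(n, k)], and on both sides the exponents of 2 add up to [(k + 1) * (m + 1)]. *)
Lemma ell_rec (k m : nat) :
  (ell (k + m.+1) k.+1 * (2 ^ k.+1 * k.+1 * bell m.+1) =
   ell (k + m.+1) k * (2 ^ m.+1 * m.+1 * bell m))%N.
Proof.
rewrite /ell addKn -addSnnS addKn.
have := mul_bin_left (k.+1 + m) k; rewrite addSnnS addKn => b.
have e : (2 ^ (k.+1 * m) * 2 ^ k.+1 = 2 ^ (k * m.+1) * 2 ^ m.+1)%N.
  by rewrite -!expnD; congr expn; lia.
transitivity ((k.+1 * 'C(k + m.+1, k.+1)) * (2 ^ (k.+1 * m) * 2 ^ k.+1)
  * bell m * bell m.+1)%N; first by ring.
by rewrite b e; ring.
Qed.

(* [y ^+ 2 - y] is [(y - 1 / 2) ^+ 2 - 1 / 4]: the Gaussian factor divided out is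
   centred at [mu R n + 1 / 2]. *)
Definition ell_flat (R : realType) (n k : nat) : R :=
  (ell n k)%:R * 2 `^ ((k%:R - mu R n) ^+ 2 - (k%:R - mu R n)).

(** The factor [f_k] of the overview. It is [n / (2 * (k + 1))] times the quotient of
    [(n - k) / ln n] by the Bell ratio; both are close to 1 for [k] near [n / 2]. *)
Definition flat_ratio (R : realType) (n k : nat) : R :=
  ((n - k) * n * bell (n - k).-1)%:R
    / (2 * k.+1%:R * ln n%:R * (bell (n - k))%:R).

Lemma ell_flatK (R : realType) (n k : nat) :
  (ell n k)%:R = ell_flat R n k
    * 2 `^ ((k%:R - mu R n) - (k%:R - mu R n) ^+ 2) :> R.
Proof. by rewrite -mulrA -pow2D addrA subrK subrr powRr0 mulr1. Qed.

Lemma ell_flat_ge0 (R : realType) (n k : nat) : 0 <= ell_flat R n k.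
Proof. by rewrite mulr_ge0 ?powR_ge0. Qed.

(** From [k] to [k + 1] the Gaussian factor gains [2 ^ (2 * (k - mu))], that is
    [2 ^ (2 * k - n) * n / ln n]: the logarithms in [mu] produce [n / ln n]. *)
Lemma ell_flatS (R : realType) (n k : nat) : (1 < n)%N -> (k < n)%N ->
  ell_flat R n k.+1 = flat_ratio R n k * ell_flat R n k.
Proof.
move=> n1 kn; have n0 : (0 < n)%N by exact: ltnW.
have L0 : 0 < ln n%:R :> R by rewrite ln_gt0// ltr1n.
have nR0 : 0 < n%:R :> R by rewrite ltr0n.
rewrite /ell_flat /flat_ratio.
have E : (k.+1%:R - mu R n) ^+ 2 - (k.+1%:R - mu R n) =
  ((k%:R - mu R n) ^+ 2 - (k%:R - mu R n)) + (k%:R + k%:R - 2 * mu R n).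
  by rewrite -natr1; ring.
rewrite E pow2D mulrA [RHS]mulrA.
have -> : 2 `^ (k%:R + k%:R - 2 * mu R n) =
    2 ^+ k * 2 ^+ k * n%:R / (2 ^+ n * ln n%:R) :> R.
  have -> : k%:R + k%:R - 2 * mu R n =
    (k%:R + k%:R + log2 n%:R) + - (n%:R + log2 (ln n%:R)).
    by rewrite /mu; field.
  by rewrite pow2D powRN !pow2D !powR_mulrn// !pow2_log2.
rewrite [in LHS]mulrAC; congr (_ * _).
have := @ell_rec k (n - k).-1.
have -> : (n - k).-1.+1 = (n - k)%N by rewrite prednK// subn_gt0.
rewrite subnKC ?(ltnW kn)//; move: (ell n k.+1) (ell n k) => x y.
move=> /(congr1 (fun i => i%:R : R)).
rewrite !natrM !natrX.
have -> : 2 ^+ n = 2 ^+ k * 2 ^+ (n - k) :> R by rewrite -exprD subnKC// ltnW.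
have b0 : (bell (n - k))%:R != 0 :> R by rewrite pnatr_eq0 -lt0n bell_gt0.
have k0 : 2 ^+ k != 0 :> R by rewrite expf_neq0.
have nk0 : 2 ^+ (n - k) != 0 :> R by rewrite expf_neq0.
have S0 : k.+1%:R != 0 :> R by [].
have lnN0 : ln n%:R != 0 :> R by rewrite gt_eqF.
rewrite exprS.
move: (bell (n - k))%:R b0 (bell (n - k).-1)%:R (2 ^+ (n - k)) nk0 (2 ^+ k) k0
  k.+1%:R S0 (ln _) lnN0 (n - k)%:R => b b0 b' u u0 v v0 w w0
  l l0 m H.
have -> : x%:R = y%:R * (u * m * b') / (2 * v * w * b).
  by rewrite -H; field; rewrite v0 w0 b0.
by field; rewrite v0 w0 b0 l0 u0.
Qed.

(** * Bounds on the ratios of the flat profile *)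

Section FlatRatioBounds.
Variables (R : realType) (n : nat).
Hypothesis Ln : large (ln n%:R : R).
Let L : R := ln n%:R.
Let N : R := n%:R.

Lemma large_gt0 : 0 < L.
Proof. by apply: lt_le_trans (Ln.1); rewrite ltr0n. Qed.

Lemma large_mul : 1000 * L <= N /\ 1000 <= N.
Proof.
have L1 := Ln.1; have := large_n Ln; rewrite -/L -/N in L1 *.
by move=> H; split; apply: le_trans H; nra.
Qed.

Lemma mu_ub : mu R n <= N / 2.
Proof.
have N0 : 0 < N := large_n_gt0 Ln.
have : log2 L <= log2 N.
  rewrite /log2 ler_pM2r ?invr_gt0 ?(lt_le_trans _ (ln2_ge R))//.
  by rewrite ler_ln ?posrE ?large_gt0// ltW// ln_sublinear.
by rewrite /mu -/N -/L; lra.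
Qed.

Lemma mu_lb : 12 / 25 * N <= mu R n.
Proof.
have N0 : 0 < N := large_n_gt0 Ln.
have l2 := ln2_ge R.
have H1 : 0 <= log2 L.
  rewrite /log2 divr_ge0 ?ln_ge0//; last by lra.
  by have := Ln.1; rewrite -/L; lra.
have H2 : log2 N <= 2 * L.
  rewrite /log2 ler_pdivrMr; last by lra.
  by rewrite -/L; have := large_gt0; nra.
have [H3 _] := large_mul; have := large_gt0.
by rewrite /mu -/N -/L; lra.
Qed.

Variable k : nat.
Hypothesis kn : (k < n)%N.
Let m := (n - k).-1.
Let K : R := k.+1%:R.
Let mE : m.+1 = (n - k)%N. Proof. by rewrite prednK// subn_gt0. Qed.
Let b : R := (bell m)%:R.
Let B : R := (bell m.+1)%:R.
Let s : R := m.+1%:R / L.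

Let flat_ratioE : flat_ratio R n k = N / (2 * K) * (s * b / B).
Proof.
rewrite /flat_ratio -/m -mE !natrM /s /b /B -/L -/N -/K.
have L0 : L != 0 by rewrite gt_eqF// large_gt0.
have B0 : (bell m.+1)%:R != 0 :> R by rewrite pnatr_eq0 -lt0n bell_gt0.
by field; rewrite L0 B0 nat1r pnatr_eq0.
Qed.

Let B_gt0 : 0 < B. Proof. by rewrite /B ltr0n bell_gt0. Qed.
Let b_gt0 : 0 < b. Proof. by rewrite /b ltr0n bell_gt0. Qed.
Let K_gt0 : 0 < K. Proof. by rewrite /K ltr0n. Qed.
Let NE : N = k%:R + m.+1%:R. Proof. by rewrite -natrD mE subnKC ?(ltnW kn). Qed.
Let KE : K = k%:R + 1. Proof. by rewrite /K natr1. Qed.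

(** The two factors are at most [25/24], by [mu_lb], and [10/9], by [bell_ratio_lb]. The latter has
    no lower bound on [m], so the estimate reaches [k = n - 1]. *)
Lemma flat_ratio_ub : mu R n <= k%:R -> flat_ratio R n k <= 5 / 4.
Proof.
move=> muk; have muN := mu_lb; rewrite flat_ratioE.
have [_ N3] := large_mul.
have H1 : s * b / B <= 10 / 9.
  rewrite ler_pdivrMr//.
  have := @bell_ratio_lb R n Ln m; rewrite -/L -/B -/b -/s mE leq_subr.
  by move=> /(_ isT); lra.
have H2 : N / (2 * K) <= 25 / 24.
  by rewrite ler_pdivrMr ?mulr_gt0//; lra.
have H3 : 0 <= N / (2 * K) by rewrite divr_ge0// ?mulr_ge0//; lra.
have H4 : 0 <= s * b / B.
  have L0 := ltW large_gt0.
  by rewrite divr_ge0 ?(ltW B_gt0)// mulr_ge0 ?(ltW b_gt0)// divr_ge0.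
by move: (N / _) (_ / B) H1 H2 H3 H4 => u v; nra.
Qed.

(** [20/21] is the inverse of the constant in [bell_ratio_ub]. *)
Let flat_ratio_lb (c : R) : 0 <= c -> N / L <= m.+1%:R ->
  c <= N / (2 * K) -> c * (20 / 21) <= flat_ratio R n k.
Proof.
move=> c0 Nm cN; rewrite flat_ratioE ler_pM//.
rewrite ler_pdivlMr//.
have := @bell_ratio_ub R n Ln m Nm; rewrite -/L -/B -/b -/s mE leq_subr.
by move=> /(_ isT); lra.
Qed.

Let NL : N / L <= N / 100.
Proof.
have := Ln.1; rewrite -/L => L1; have [_ N0] := large_mul.
by rewrite ler_wpM2l// lef_pV2 ?posrE//; lra.
Qed.

Lemma flat_ratio_lb_left : k%:R <= mu R n -> 4 / 5 <= flat_ratio R n k.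
Proof.
move=> kmu; have muN := mu_ub; have [_ N3] := large_mul.
have := NE; have := KE => KE' NE'.
have -> : 4 / 5 = 21 / 25 * (20 / 21) :> R by lra.
apply: flat_ratio_lb; first lra.
- by apply: (le_trans NL); lra.
- by rewrite ler_pdivlMr ?mulr_gt0//; lra.
Qed.

(** Here [N / (2 * K)] is at least nearly 4/5, and [189/250 * 20/21 = 18/25] still exceeds
    [2 ^ (- 1/2)], about 0.707. *)
Lemma flat_ratio_lb_middle : k%:R <= 5 / 8 * N ->
  2 `^ (- (1 / 2)) <= flat_ratio R n k.
Proof.
move=> kN; have [_ N3] := large_mul.
have := NE; have := KE => KE' NE'.
have H : 2 `^ (- (1 / 2)) <= 18 / 25 :> R.
  have := @pow2_gt0 R (- (1 / 2)); have := @pow2D R (- (1 / 2)) (- (1 / 2)).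
  have -> : - (1 / 2) + - (1 / 2) = -1 :> R by lra.
  by rewrite powR_inv1//; nra.
apply: (le_trans H).
have -> : 18 / 25 = 189 / 250 * (20 / 21) :> R by lra.
apply: flat_ratio_lb; first lra.
- by apply: (le_trans NL); lra.
- by rewrite ler_pdivlMr ?mulr_gt0//; lra.
Qed.

Let KN : K <= N. Proof. by rewrite /K /N ler_nat. Qed.

Lemma flat_ratio_lb_right : N / L <= (n - k)%:R ->
  2 `^ (- (9 / 8)) <= flat_ratio R n k.
Proof.
rewrite -mE => kN; have [_ N3] := large_mul.
(* From [K <= N] the ratio is at least [1/2 * 20/21], and [2 ^ (- 9/8)], about 0.459, lies below
   that. *)
have H : 2 `^ (- (9 / 8)) <= 10 / 21 :> R.
  have -> : - (9 / 8) = - (1 / 8) + - 1 :> R by lra.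
  rewrite pow2D powR_inv1//.
  have := @pow2_gt0 R (- (1 / 8)).
  have : (2 `^ (- (1 / 8))) ^+ 8 = 1 / 2 :> R.
    rewrite -powR_mulrn ?powR_ge0// -powRrM.
    have -> : - (1 / 8) * 8 = -1 :> R by lra.
    by rewrite powR_inv1//; lra.
  move: (2 `^ _) => q q8 q0.
  suff : q <= 20 / 21 by lra.
  rewrite leNgt; apply/negP => qq.
  have q2 : 9 / 10 <= q ^+ 2 by nra.
  have q4 : 4 / 5 <= (q ^+ 2) ^+ 2 by nra.
  have : 3 / 5 <= ((q ^+ 2) ^+ 2) ^+ 2 by nra.
  by rewrite -!exprM q8; lra.
apply: (le_trans H).
have -> : 10 / 21 = 1 / 2 * (20 / 21) :> R by lra.
apply: flat_ratio_lb => //.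
by have := KN; rewrite ler_pdivlMr ?mulr_gt0//; lra.
Qed.

(** Serves the last indices, where [n - k] is below [N / L], through [bell_ratio_crude]. *)
Lemma flat_ratio_lb_crude : (20 * L)^-1 <= flat_ratio R n k.
Proof.
have L0 := large_gt0; rewrite flat_ratioE.
have H1 : (10 * L)^-1 <= s * b / B.
  rewrite ler_pdivlMr// mulrC ler_pdivrMr ?mulr_gt0//.
  have := @bell_ratio_crude R m; rewrite -/B -/b.
  suff -> : s * b * (10 * L) = 10 * m.+1%:R * b by [].
  by rewrite /s; field; rewrite gt_eqF.
have H2 : 1 / 2 <= N / (2 * K).
  by have := KN; rewrite ler_pdivlMr ?mulr_gt0//; lra.
have -> : (20 * L)^-1 = 1 / 2 * (10 * L)^-1 by field; rewrite gt_eqF.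
by rewrite ler_pM// ?invr_ge0; lra.
Qed.

End FlatRatioBounds.

(** * Growth of the flat profile, and Gaussian sums *)

Section FlatProfile.
Variables (R : realType) (n : nat).
Hypothesis Ln : large (ln n%:R : R).
Let L : R := ln n%:R.
Let N : R := n%:R.

Let n_gt1 : (1 < n)%N.
Proof.
rewrite -(ltr_nat R); apply: lt_le_trans (large_mul Ln).2.
by rewrite ltr_nat.
Qed.

Lemma ell_flat_chain (c : R) (p q : nat) : (p <= q)%N -> (q <= n)%N ->
  (forall k, (p <= k < q)%N -> 2 `^ (- c) <= flat_ratio R n k) ->
  ell_flat R n p * 2 `^ (- c * (q%:R - p%:R)) <= ell_flat R n q.
Proof.
move=> + + H; elim: q H => [|q IH] H.
  by rewrite leqn0 => /eqP ->; rewrite subrr mulr0 powRr0 mulr1.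
rewrite leq_eqVlt => /predU1P[->|pq] qn.
  by rewrite subrr mulr0 powRr0 mulr1.
rewrite ell_flatS//.
have -> : - c * (q.+1%:R - p%:R) = - c * (q%:R - p%:R) + - c.
  by rewrite -natr1; ring.
rewrite pow2D mulrA mulrC; apply: ler_pM.
- exact: powR_ge0.
- by rewrite mulr_ge0 ?ell_flat_ge0 ?powR_ge0.
- by apply: H; rewrite -ltnS pq ltnSn.
- apply: IH => //; last exact: ltnW.
  by move=> k /andP[pk kq]; apply: H; rewrite pk ltnS ltnW.
Qed.

Variable k0 : nat.
Hypothesis k0_ge : mu R n <= k0%:R.
Hypothesis k0_lt : k0%:R < mu R n + 1.

Lemma center_leq : (k0 <= n)%N.
Proof.
rewrite -(ler_nat R); have := k0_lt; have := mu_ub Ln; have := large_mul Ln.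
by rewrite -/N => -[_ N0]; lra.
Qed.

(** [k0], the least integer at or above [mu], is the reference point. Each step away from it, on
    either side, multiplies the flat profile by at most [5/4]. *)
Lemma ell_flat_right (i : nat) : (k0 + i <= n)%N ->
  ell_flat R n (k0 + i) <= ell_flat R n k0 * (5 / 4) ^+ i.
Proof.
elim: i => [|i IH] kn; first by rewrite addn0 expr0 mulr1.
rewrite addnS in kn *.
rewrite ell_flatS// exprS [leRHS]mulrCA; apply: ler_pM; rewrite ?ell_flat_ge0 ?IH//.
- by rewrite /flat_ratio divr_ge0// !mulr_ge0// ltW// large_gt0.
- apply: flat_ratio_ub => //; apply: (le_trans k0_ge).
  by rewrite ler_nat leq_addr.
- exact: ltnW.
Qed.

Lemma ell_flat_left (i : nat) : (i <= k0)%N ->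
  ell_flat R n (k0 - i) <= ell_flat R n k0 * (5 / 4) ^+ i.
Proof.
elim: i => [|i IH] ik; first by rewrite subn0 expr0 mulr1.
have E : (k0 - i)%N = (k0 - i.+1).+1 by rewrite -subSn.
have kn : (k0 - i.+1 < n)%N by rewrite -E (leq_trans _ center_leq)// leq_subr.
have := IH (ltnW ik); rewrite E ell_flatS// exprS.
(* [k0 < mu + 1] puts every index left of [k0] below [mu]. *)
have r45 : 4 / 5 <= flat_ratio R n (k0 - i.+1).
  apply: flat_ratio_lb_left => //.
  rewrite natrB// -[i.+1%:R]natr1.
  by have := k0_lt; have := ler0n R i; lra.
have := ell_flat_ge0 R n (k0 - i.+1); move: (flat_ratio _ _ _) r45 => r r45.
set u := ell_flat R n (k0 - i.+1); set v := ell_flat R n k0.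
set w := (5 / 4) ^+ i.
by move: u v w => u v w; nra.
Qed.

Let pow2_expR (y : R) : 2 `^ y = expR (y * ln 2).
Proof. by rewrite /powR pnatr_eq0. Qed.

(* The crude factor [(20 L)^-1] is only paid at the last [n / L + 1] indices. *)
Lemma ell_flat_far (p q : nat) : (p <= q)%N -> (q <= n)%N ->
  5 / 8 * N - 1 <= p%:R ->
  ell_flat R n p * 2 `^ (- (9 / 8) * (q%:R - p%:R) - N / 250) <= ell_flat R n q.
Proof.
move=> pq qn pN; have L0 := large_gt0 Ln; have [N1 N2] := large_mul Ln.
rewrite -/L -/N in L0 N1 N2.
pose d := (Num.truncn (N / L)).+1.
have /andP[d1 d2] : (Num.truncn (N / L))%:R <= N / L < d%:R.
  by apply: Num.Theory.truncn_itv; rewrite divr_ge0// ltW.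
(* The truncated exponent counts the steps taken at or beyond [n - d]; if [p] is already beyond, it
   starts positive, which only weakens the bound. Before [n - d], [flat_ratio_lb_right] applies
   because [d > N / L]. *)
have H j : (p + j <= n)%N -> ell_flat R n p * 2 `^ (- (9 / 8) * j%:R)
    * (20 * L)^-1 ^+ (p + j - (n - d)) <= ell_flat R n (p + j).
  elim: j => [|j IH] jn.
    rewrite mulr0 powRr0 mulr1 addn0 ler_piMr ?ell_flat_ge0//.
    rewrite exprn_ile1// ?invr_ge0; last first.
      rewrite invf_le1; have := Ln.1; rewrite -/L; lra.
    by rewrite mulr_ge0// ltW.
  rewrite addnS in jn *; rewrite ell_flatS//.
  have := IH (ltnW jn).
  have -> : 2 `^ (- (9 / 8) * j.+1%:R) = 2 `^ (- (9 / 8)) * 2 `^ (- (9 / 8) * j%:R) :> R.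
    by rewrite -pow2D; congr (_ `^ _); rewrite -natr1; ring.
  have c1 : 2 `^ (- (9 / 8)) <= 1 :> R.
    by have := @ler_pow2 R (- (9 / 8)) 0; rewrite powRr0; apply; rewrite oppr_le0 divr_ge0.
  have c0 := @pow2_gt0 R (- (9 / 8)).
  have w0 : 0 < (20 * L)^-1 by rewrite invr_gt0 mulr_gt0.
  have r1 := flat_ratio_lb_crude Ln jn; rewrite -/L in r1.
  have r2 := @flat_ratio_lb_right R n Ln _ jn; rewrite -/L -/N in r2.
  have e0 := powR_ge0 2 (- (9 / 8) * j%:R : R).
  have u0 := ell_flat_ge0 R n p.
  move: (20 * L)^-1 w0 (2 `^ (- (9 / 8))) c0 c1 (2 `^ (- (9 / 8) * j%:R)) e0
    (flat_ratio _ _ _) r1 r2 (ell_flat R n p) u0 (ell_flat R n (p + j))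
    => w w0 a a0 a1 e e0 r r1 r2 u u0 z.
  have [jd|jd] := leqP (n - d) (p + j).
    rewrite subSn// exprS; move: (w ^+ _) (exprn_ge0 (p + j - (n - d)) (ltW w0)).
    move=> v v0 H.
    have -> : u * (a * e) * (w * v) = (a * w) * (u * e * v) by ring.
    apply: ler_pM => //; [by rewrite mulr_ge0 ?ltW|by rewrite !mulr_ge0|].
    by apply: le_trans r1; rewrite ler_piMl// ltW.
  have -> : ((p + j).+1 - (n - d) = p + j - (n - d))%N by move: jd; clear; lia.
  move: (w ^+ _) (exprn_ge0 (p + j - (n - d)) (ltW w0)) => v v0 H.
  have -> : u * (a * e) * v = a * (u * e * v) by ring.
  apply: ler_pM => //; [by rewrite ltW|by rewrite !mulr_ge0|].
  by apply: r2; apply: (le_trans (ltW d2)); rewrite ler_nat; move: jd; clear; lia.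
have := H (q - p)%N; rewrite subnKC// => /(_ qn); apply: le_trans.
rewrite natrB// pow2D -mulrA ler_wpM2l ?ell_flat_ge0// ler_wpM2l ?powR_ge0//.
(* So [N / L + 1] crude steps cost at most a factor [expR (2 * N / 1000)], which is at most
   [2 ^ (N / 250)] as [ln 2 >= 1/2]. *)
have L20 : 20 * L <= expR (L / 1000).
  by apply: le_trans Ln.2; rewrite -/L; have := Ln.1; rewrite -/L; nra.
have eI : expR (- (L / 1000)) <= (20 * L)^-1.
  by rewrite expRN lef_pV2 ?posrE ?expR_gt0// mulr_gt0.
apply: le_trans (_ : expR (- (L / 1000)) ^+ (q - (n - d)) <= _); last first.
  by rewrite lerXn2r// nnegrE ?expR_ge0// invr_ge0 mulr_ge0 ?ltW.
rewrite -expRM_natl pow2_expR ler_expR.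
have dd : (q - (n - d))%:R <= N / L + 1.
  by apply: (le_trans (y := d%:R)); [rewrite ler_nat; move: qn; clear; lia|rewrite /d -natr1; lra].
have LN : (N / L + 1) * L <= 2 * N by rewrite mulrDl divfK ?gt_eqF//; lra.
have l2 := ln2_ge R.
have D0 : (q - (n - d))%:R * L <= 2 * N by apply: le_trans LN; rewrite ler_pM2r.
move: D0; set D := (q - (n - d))%:R => D0.
have : 1 / 2 * N <= ln 2 * N by rewrite ler_wpM2r.
by lra.
Qed.

End FlatProfile.

(** Bounds [ell] at distance [i] from [k0], relative to [ell n k0]: [5/4] per step comes from the
    flat profile, and [t] records where [mu] lies between [k0 - 1] and [k0]. *)
Definition gauss_term (R : realType) (t : R) (i : nat) : R :=
  (5 / 4 * t) ^+ i / 2 ^+ (i * i.-1).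

Lemma gauss_termS (R : realType) (t : R) (i : nat) :
  gauss_term t i.+1 = gauss_term t i * (5 / 4 * t / 2 ^+ (2 * i)).
Proof.
rewrite /gauss_term.
have -> : (i.+1 * i.+1.-1 = i * i.-1 + 2 * i)%N by case: i => //= i; lia.
by rewrite exprD invfM [_ ^+ i.+1]exprSr; ring.
Qed.

Lemma gauss_term_ge0 (R : realType) (t : R) (i : nat) :
  0 <= t -> 0 <= gauss_term t i.
Proof. by move=> t0; rewrite divr_ge0// ?exprn_ge0// mulr_ge0// divr_ge0. Qed.

(** The third term is at most [25/64] and later ratios are at most [1/6], so the terms after the
    first two add up to at most [6/5 * 25/64 < 1/2]. [H] carries this geometric remainder through
    the induction. *)
Lemma sum_gauss_term (R : realType) (t : R) (M : nat) : 0 <= t <= 1 ->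
  \sum_(0 <= i < M) gauss_term t i <= 3 / 2 + 5 / 4 * t.
Proof.
move=> /andP[t0 t1].
have h0 : gauss_term t 0 = 1 by rewrite /gauss_term !expr0 divr1.
have h1 : gauss_term t 1 = 5 / 4 * t.
  by rewrite gauss_termS h0 muln0 expr0 divr1 mul1r.
have h2 : gauss_term t 2 = 25 / 64 * t ^+ 2.
  by rewrite gauss_termS h1 muln1; field.
have H j : \sum_(0 <= i < j.+2) gauss_term t i <=
    3 / 2 + 5 / 4 * t - 6 / 5 * gauss_term t j.+2.
  elim: j => [|j IH].
    rewrite !big_nat_recr//= big_nil h0 h1 h2.
    have : t ^+ 2 <= 1 by rewrite exprn_ile1.
    by lra.
  rewrite big_nat_recr//=; have := @gauss_term_ge0 R t j.+2 t0.
  have : gauss_term t j.+3 <= gauss_term t j.+2 * (1 / 6).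
    rewrite gauss_termS ler_wpM2l ?gauss_term_ge0//.
    rewrite ler_pdivrMr ?exprn_gt0//.
    have : 2 ^+ (2 * 2) <= 2 ^+ (2 * j.+2) :> R.
      by rewrite ler_eXn2l ?ltr1n// leq_mul2l.
    have -> : 2 ^+ (2 * 2) = 16 :> R by rewrite -natrX.
    by lra.
  by move: (gauss_term t j.+3) (gauss_term t j.+2) IH => a b; lra.
case: M => [|[|j]].
- by rewrite big_nil; lra.
- by rewrite big_nat1 h0; lra.
- by apply: (le_trans (H j)); have := @gauss_term_ge0 R t j.+2 t0; lra.
Qed.

Lemma pow2_gauss (R : realType) (u : R) (i : nat) :
  (5 / 4) ^+ i * 2 `^ (u * i%:R - i%:R * (i%:R - 1)) = gauss_term (2 `^ u) i.
Proof.
rewrite /gauss_term [in RHS]exprMn -mulrA; congr (_ * _).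
rewrite pow2D powRrM powR_mulrn ?powR_ge0//; congr (_ * _).
rewrite powRN -powR_mulrn//; congr (_ `^ _)^-1.
by case: i => [|i] /=; rewrite ?mul0r// natrM -[i.+1%:R]natr1 addrK.
Qed.

Lemma sum_pow2_above (R : realType) (c : R) (M : nat) :
  \sum_(0 <= k < M | c <= k%:R) 2 `^ (c - k%:R) <= 2.
Proof.
have [cM|Mc] := leP c M%:R; last first.
  rewrite big_nat_cond big1 => [|k /andP[/andP[_ kM] ck]].
    by [].
  move: (lt_le_trans Mc ck); rewrite ltr_nat; lia.
(* Subtracting a bound for the missing tail of the geometric series makes the estimate inductive. *)
suff : \sum_(0 <= k < M | c <= k%:R) 2 `^ (c - k%:R) <= 2 - 2 * 2 `^ (c - M%:R).
  by have := @pow2_gt0 R (c - M%:R); lra.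
have le1 (j : nat) : c <= j%:R -> 2 `^ (c - j%:R) <= 1.
  by move=> cj; rewrite -[leRHS](powRr0 2); apply: ler_pow2; lra.
elim: M cM => [|M IH] cM.
  by rewrite big_nil; have := le1 _ cM; lra.
rewrite big_mkcond big_nat_recr//= -big_mkcond/=.
have E : 2 `^ (c - M%:R) = 2 * 2 `^ (c - M.+1%:R).
  by rewrite -[X in _ = X * _](powRr1 (a := 2))// -pow2D -natr1; congr (_ `^ _); ring.
have [cM'|cM'] := leP c M%:R; first by have := IH cM'; lra.
rewrite addr0 big_nat_cond big1 => [|k /andP[/andP[_ kM] ck]].
  by have := le1 _ cM; lra.
move: (lt_le_trans cM' ck); rewrite ltr_nat; lia.
Qed.

Lemma sum_pow2_below (R : realType) (c : R) (M : nat) :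
  \sum_(0 <= k < M | k%:R <= c) 2 `^ (k%:R - c) <= 2.
Proof.
(* The second bound carries the induction: it doubles at each step, and it implies the first one
   whenever a term is added. *)
suff /andP[] : (\sum_(0 <= k < M | k%:R <= c) 2 `^ (k%:R - c) <= 2) &&
    (\sum_(0 <= k < M | k%:R <= c) 2 `^ (k%:R - c) <= 2 `^ (M%:R - c)) by [].
elim: M => [|M /andP[IH1 IH2]]; first by rewrite big_nil ler0n powR_ge0.
have E : 2 `^ (M.+1%:R - c) = 2 * 2 `^ (M%:R - c).
  by rewrite -[X in _ = X * _](powRr1 (a := 2))// -pow2D -natr1; congr (_ `^ _); ring.
have p0 := @pow2_gt0 R (M%:R - c).
rewrite big_mkcond big_nat_recr//= -big_mkcond/= E.
case: ifPn => [Mc|_]; last by apply/andP; split; lra.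
have : 2 `^ (M%:R - c) <= 1.
  by rewrite -[leRHS](powRr0 2); apply: ler_pow2; lra.
by move=> p1; apply/andP; split; lra.
Qed.

(** Turns the constant of [scrL_ub] into a power of 2. *)
Lemma pow2_15_8 (R : realType) : 57 / 16 <= 2 `^ (15 / 8) :> R.
Proof.
have -> : 15 / 8 = 2%:R + - (1 / 8) :> R by lra.
rewrite pow2D powR_mulrn//.
have q0 := @pow2_gt0 R (- (1 / 8)).
have : (2 `^ (- (1 / 8))) ^+ 8 = 1 / 2 :> R.
  rewrite -powR_mulrn ?powR_ge0// -powRrM.
  have -> : - (1 / 8) * 8 = -1 :> R by lra.
  by rewrite powR_inv1//; lra.
move: (2 `^ _) q0 => q q0 q8.
have -> : 2 ^+ 2 = 4 :> R by rewrite -natrX.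
suff : 57 / 64 <= q by lra.
rewrite leNgt; apply/negP => qq.
have q2 : q ^+ 2 <= 4 / 5 by nra.
have q20 : 0 <= q ^+ 2 by nra.
have q4 : (q ^+ 2) ^+ 2 <= 16 / 25 by nra.
have q40 : 0 <= (q ^+ 2) ^+ 2 by nra.
have : ((q ^+ 2) ^+ 2) ^+ 2 < 1 / 2 by nra.
by rewrite -!exprM q8; lra.
Qed.

(** * Bounds on the weights and their total *)

Section Profile.
Variables (R : realType) (n : nat).
Hypothesis Ln : large (ln n%:R : R).
Let N : R := n%:R.

Variable k0 : nat.
Hypothesis k0_ge : mu R n <= k0%:R.
Hypothesis k0_lt : k0%:R < mu R n + 1.
Let theta : R := k0%:R - mu R n.
(** By [ell_flatK] this is [ell n k0]. *)
Let G : R := ell_flat R n k0 * 2 `^ (theta - theta ^+ 2).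

Let theta_ge0 : 0 <= theta. Proof. by rewrite /theta subr_ge0. Qed.
Let theta_lt1 : theta < 1.
Proof. by rewrite /theta ltrBlDr addrC. Qed.

Let G_ge0 : 0 <= G.
Proof. by rewrite mulr_ge0 ?ell_flat_ge0 ?powR_ge0. Qed.

Lemma ell_right (i : nat) : (k0 + i <= n)%N ->
  (ell n (k0 + i))%:R <= G * gauss_term (2 `^ (- 2 * theta)) i.
Proof.
move=> kn; rewrite ell_flatK -pow2_gauss.
have -> : (k0 + i)%:R - mu R n - ((k0 + i)%:R - mu R n) ^+ 2 =
  (theta - theta ^+ 2) + (- 2 * theta * i%:R - i%:R * (i%:R - 1)).
  by rewrite natrD /theta; ring.
rewrite pow2D /G [leRHS]mulrACA ler_wpM2r ?mulr_ge0 ?powR_ge0//.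
exact: ell_flat_right.
Qed.

Lemma ell_left (i : nat) : (i <= k0)%N ->
  (ell n (k0 - i))%:R <= G * gauss_term (2 `^ (2 * theta - 2)) i.
Proof.
move=> ik; rewrite ell_flatK -pow2_gauss.
have -> : (k0 - i)%:R - mu R n - ((k0 - i)%:R - mu R n) ^+ 2 =
  (theta - theta ^+ 2) + ((2 * theta - 2) * i%:R - i%:R * (i%:R - 1)).
  by rewrite natrB// /theta; ring.
rewrite pow2D /G [leRHS]mulrACA ler_wpM2r ?mulr_ge0 ?powR_ge0//.
exact: ell_flat_left.
Qed.

Let pow2_itv (y : R) : y <= 0 -> 0 <= 2 `^ y <= 1.
Proof. by move=> y0; rewrite powR_ge0 -[leRHS](powRr0 2) ler_pow2. Qed.

(** With [t] for the right side and [s] for the left, the two sums give [G * (2 + 5/4 * (t + s))].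
    Since [t * s = 1/4] and both are at most 1, [t + s <= 5/4], whence [2 + 25/16 = 57/16]. *)
Lemma scrL_ub : (scrL n)%:R <= 57 / 16 * G.
Proof.
have k0n := center_leq Ln k0_lt.
have t01 : 0 <= 2 `^ (- 2 * theta) <= 1.
  by apply: pow2_itv; have := theta_ge0; lra.
have s01 : 0 <= 2 `^ (2 * theta - 2) <= 1.
  by apply: pow2_itv; have := theta_lt1; lra.
rewrite /scrL natr_sum (big_cat_nat (n := k0))//=; last exact: leqW.
have H1 : \sum_(k0 <= k < n.+1) (ell n k)%:R
    <= G * (3 / 2 + 5 / 4 * 2 `^ (- 2 * theta)).
  rewrite -{1}[k0]add0n big_addn.
  apply: le_trans (_ : G * \sum_(0 <= i < n.+1 - k0)
      gauss_term (2 `^ (- 2 * theta)) i <= _).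
    rewrite mulr_sumr; apply: ler_sum_nat => i /andP[_ ik].
    by rewrite addnC; apply: ell_right; move: ik; rewrite ltn_subRL ltnS.
  by rewrite ler_wpM2l ?sum_gauss_term.
have H2 : \sum_(0 <= k < k0) (ell n k)%:R
    <= G * (1 / 2 + 5 / 4 * 2 `^ (2 * theta - 2)).
  rewrite big_nat_rev/=.
  apply: le_trans (_ : G * \sum_(0 <= i < k0)
      gauss_term (2 `^ (2 * theta - 2)) i.+1 <= _).
    rewrite mulr_sumr; apply: ler_sum_nat => i /andP[_ ik].
    by rewrite add0n; apply: ell_left.
  rewrite ler_wpM2l//; have := sum_gauss_term k0.+1 s01.
  rewrite big_nat_recl//= [gauss_term _ 0]/gauss_term !expr0 divr1.
  set u := \sum_(0 <= i < k0) _; set v := 2 `^ _; lra.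
have ts : 2 `^ (- 2 * theta) * 2 `^ (2 * theta - 2) = 1 / 4 :> R.
  rewrite -pow2D; have -> : - 2 * theta + (2 * theta - 2) = - (2%:R) by ring.
  by rewrite powR_invn//; field.
have t4 : 1 / 4 <= 2 `^ (- 2 * theta) :> R.
  by rewrite -ts ler_piMr ?powR_ge0//; case/andP: s01.
have s4 : 1 / 4 <= 2 `^ (2 * theta - 2) :> R.
  by rewrite -ts ler_piMl ?powR_ge0//; case/andP: t01.
move: (2 `^ (- 2 * theta)) (2 `^ (2 * theta - 2)) t01 s01 H1 H2 ts t4 s4.
move=> t s /andP[t0 t1] /andP[s0 s1] H1 H2 ts t4 s4.
have st : t + s <= 5 / 4 by nra.
apply: (le_trans (lerD H2 H1)); rewrite -mulrDr mulrC ler_wpM2r//; lra.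
Qed.

(** The single index [k1], the first one at distance at least [x] to the right of [mu], already
    carries enough mass. *)
Lemma ell_lb (x : R) (k1 : nat) : 1 < x -> (k1 <= n)%N ->
  mu R n + x <= k1%:R -> k1%:R < mu R n + x + 1 ->
  2 `^ (- (x + 1) ^+ 2 - 1) * (scrL n)%:R <= (ell n k1)%:R.
Proof.
move=> x1 k1n k1x k1x1.
have k01 : (k0 <= k1)%N.
  by rewrite -ltnS -(ltr_nat R) -natr1; have := k0_lt; lra.
set y : R := k1%:R - mu R n.
have yx : x <= y by rewrite /y; lra.
have yx1 : y < x + 1 by rewrite /y; lra.
have th0 := theta_ge0; have th1 := theta_lt1.
(* [e] bounds from below the binary logarithm of the change of the flat profile from [k0] to [k1];
   [15/8] pays for [scrL_ub]. *)
suff [e [He Hee]] : exists e, ell_flat R n k0 * 2 `^ e <= ell_flat R n k1 /\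
    - (x + 1) ^+ 2 - 1 + (15 / 8 + (theta - theta ^+ 2)) <= e + (y - y ^+ 2).
  rewrite ell_flatK -/y.
  apply: (le_trans (y := ell_flat R n k0 * 2 `^ e * 2 `^ (y - y ^+ 2))); last first.
    by rewrite ler_wpM2r ?powR_ge0.
  rewrite -mulrA -pow2D; apply: (le_trans (y := ell_flat R n k0 *
    2 `^ (- (x + 1) ^+ 2 - 1 + (15 / 8 + (theta - theta ^+ 2))))); last first.
    by rewrite ler_wpM2l ?ell_flat_ge0 ?ler_pow2.
  rewrite (pow2D (- (x + 1) ^+ 2 - 1)) [leRHS]mulrCA ler_wpM2l ?powR_ge0//.
  apply: (le_trans scrL_ub); rewrite /G [leLHS]mulrCA ler_wpM2l ?ell_flat_ge0//.
  by rewrite (pow2D (15 / 8)) ler_wpM2r ?powR_ge0// pow2_15_8.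
have yk : k1%:R - k0%:R = y - theta by rewrite /y /theta; ring.
have [k1N|k1N] := leP k1%:R (5 / 8 * N).
  exists (- (1 / 2) * (k1%:R - k0%:R)); split; last first.
    (* [q1] and [q2] account for the gap between the exponents up to [(x + 1) / 2 - 15/16], positive
       because [x > 1]. *)
    have q1 : 0 <= (theta - 1 / 4) ^+ 2 by rewrite sqr_ge0.
    have q2 : 0 <= (x + 1 - y) * (x + 1 + y - 1 / 2) by rewrite mulr_ge0; lra.
    by rewrite yk; move: (theta) (y) q1 q2 => t z q1 q2; nra.
  apply: ell_flat_chain => // k /andP[_ kk].
  apply: flat_ratio_lb_middle => //; first exact: leq_trans k1n.
  by apply: le_trans k1N; rewrite ler_nat ltnW.
have [_ N1] := large_mul Ln; rewrite -/N in N1.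
pose p := Num.truncn (5 / 8 * N).
have /andP[p1 p2] : p%:R <= 5 / 8 * N < p.+1%:R.
  by apply: Num.Theory.truncn_itv; lra.
rewrite -natr1 in p2.
have muN := mu_ub Ln; rewrite -/N in muN.
have k0p : k0%:R <= p%:R - (1 / 8 * N - 2) :> R by have := k0_lt; lra.
have k0p' : (k0 <= p)%N by rewrite -(ler_nat R); lra.
have pk1 : (p <= k1)%N by rewrite -(ler_nat R); lra.
(* Compared with one bit per step, half a bit is saved on at least [N / 8 - 2] steps up to [p], and
   [1/8] is lost on at most [3/8 * N + 1] steps after it. As [1/16 - 3/64 - 1/250 > 0], two bits
   remain to spare. *)
exists (- (1 / 2) * (p%:R - k0%:R) + (- (9 / 8) * (k1%:R - p%:R) - N / 250)).
have k1N' : k1%:R <= N by rewrite ler_nat.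
split; last first.
  apply: (le_trans (y := 2 - (y - theta) + (y - y ^+ 2))); first by nra.
  by rewrite -yk; lra.
rewrite pow2D mulrA.
apply: (le_trans _ (ell_flat_far Ln pk1 k1n _)); last by rewrite -/N; lra.
rewrite ler_wpM2r ?powR_ge0//; apply: ell_flat_chain => //.
  exact: leq_trans k1n.
move=> k /andP[_ kk]; apply: flat_ratio_lb_middle => //.
  by apply: leq_trans k1n; apply: leq_trans pk1.
by apply: le_trans p1; rewrite ler_nat ltnW.
Qed.

(** The last factor, geometric in the excess over [x], makes the tail summable. The flat profile
    gains at most half a bit per step, since [5/4 <= 2 ^ (1/2)], and the quadratic exponent absorbs
    this. *)
Lemma ell_tail (x : R) (k : nat) : 2 <= x -> (k <= n)%N ->
  x <= `|k%:R - mu R n| ->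
  (ell n k)%:R <=
    (scrL n)%:R * 2 `^ (1 - (x - 1) ^+ 2) * 2 `^ (x - `|k%:R - mu R n|).
Proof.
move=> x2 kn; set y := k%:R - mu R n => xy.
have k0n := center_leq Ln k0_lt.
have th0 := theta_ge0; have th1 := theta_lt1.
(* [theta - theta ^ 2] is nonnegative because [0 <= theta < 1]. *)
have H0 : ell_flat R n k0 <= (scrL n)%:R.
  apply: (le_trans (y := (ell n k0)%:R)).
    rewrite [leRHS]ell_flatK -/theta ler_peMr ?ell_flat_ge0//.
    by rewrite -[leLHS](powRr0 2) ler_pow2//; nra.
  rewrite ler_nat /scrL.
  by rewrite (bigD1_seq k0) ?mem_index_iota ?iota_uniq//= leq_addr.
have H1 (i : nat) : (5 / 4) ^+ i <= 2 `^ (i%:R / 2) :> R.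
  rewrite [i%:R / 2]mulrC powRrM powR_mulrn ?powR_ge0//; apply: lerXn2r.
  - by rewrite nnegrE divr_ge0.
  - by rewrite nnegrE powR_ge0.
  - have := @pow2D R 2^-1 2^-1; have -> : 2^-1 + 2^-1 = 1 :> R by lra.
    by rewrite powRr1//; have := @pow2_gt0 R 2^-1; nra.
have [i [Hi iy]] : exists i : nat, ell_flat R n k <= ell_flat R n k0 * (5 / 4) ^+ i
    /\ i%:R <= `|y| + 1.
  have [kk|kk] := leqP k0 k.
    exists (k - k0)%N; split.
      by rewrite -{1}(subnKC kk); apply: ell_flat_right => //; rewrite subnKC.
    rewrite natrB//; have := ler_norm y; rewrite {1}/y.
    by move: (`|y|) => a; have := th0; rewrite /theta; lra.
  exists (k0 - k)%N; split.
    by rewrite -{1}(subKn (ltnW kk)); apply: ell_flat_left => //; rewrite leq_subr.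
  rewrite natrB 1?ltnW//; have := ler_norm (- y); rewrite normrN {1}/y.
  by move: (`|y|) => a; have := th1; rewrite /theta; lra.
rewrite ell_flatK -/y.
apply: (le_trans (y := ell_flat R n k0 * (5 / 4) ^+ i * 2 `^ (y - y ^+ 2))).
  by rewrite ler_wpM2r ?powR_ge0.
rewrite -[leLHS]mulrA -[leRHS]mulrA; apply: ler_pM => //; first exact: ell_flat_ge0.
apply: (le_trans (y := 2 `^ (i%:R / 2) * 2 `^ (y - y ^+ 2))).
  by rewrite ler_wpM2r ?powR_ge0.
rewrite -!pow2D ler_pow2//.
have y2 : y ^+ 2 = `|y| ^+ 2 by rewrite real_normK ?num_real.
have yy := ler_norm y; rewrite y2.
by move: (`|y|) xy iy yy => a xy iy yy; nra.
Qed.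

Lemma sum_ell_tail (x : R) : 2 <= x ->
  \sum_(0 <= k < n.+1 | x <= `|k%:R - mu R n|) (ell n k)%:R
    <= 2 `^ (- (x - 2) ^+ 2 + 2) * (scrL n)%:R.
Proof.
move=> x2.
apply: (le_trans (y := \sum_(0 <= k < n.+1 | x <= `|k%:R - mu R n|)
  (scrL n)%:R * 2 `^ (1 - (x - 1) ^+ 2) * 2 `^ (x - `|k%:R - mu R n|))).
  rewrite big_nat_cond [leRHS]big_nat_cond; apply: ler_sum => k /andP[/andP[_ kn] xk].
  exact: ell_tail.
rewrite -mulr_sumr -mulrA [leRHS]mulrC ler_wpM2l//.
(* Each side of [mu] contributes a geometric sum of at most 2. *)
have H : \sum_(0 <= k < n.+1 | x <= `|k%:R - mu R n|) 2 `^ (x - `|k%:R - mu R n|) <= 4.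
  have := lerD (sum_pow2_above (mu R n + x) n.+1) (sum_pow2_below (mu R n - x) n.+1).
  have -> : 2 + 2 = 4 :> R by lra.
  apply: le_trans; rewrite big_mkcond [in leRHS]big_mkcond/=.
  rewrite [X in _ <= _ + X]big_mkcond/= -big_split/=; apply: ler_sum => k _.
  case: ifPn => [xk|_]; last by apply: addr_ge0; case: ifP => // _; rewrite powR_ge0.
  have [yk|yk] := leP 0 (k%:R - mu R n).
    rewrite ger0_norm// in xk *.
    have -> : mu R n + x <= k%:R by lra.
    rewrite ler_wpDr//; first by case: ifP => // _; rewrite powR_ge0.
    by rewrite ler_pow2//; lra.
  rewrite ltr0_norm// in xk *.
  have -> : k%:R <= mu R n - x by lra.
  rewrite ler_wpDl//; first by case: ifP => // _; rewrite powR_ge0.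
  by rewrite ler_pow2//; lra.
apply: (le_trans (ler_wpM2l (powR_ge0 _ _) H)).
have -> : 4 = 2 `^ 2%:R :> R by rewrite powR_mulrn// -natrX.
(* [3 - (x - 1) ^ 2 <= 2 - (x - 2) ^ 2] holds exactly when [x >= 2]. *)
by rewrite -pow2D ler_pow2//; nra.
Qed.

End Profile.

(** * The law *)

Section LawL.
Variables (d : measure_display) (T : measurableType d) (R : realType).
Variables (P : probability T R) (X : {RV P >-> R}) (n : nat).
Hypothesis XL : has_law_L X n.

Let S : R := (scrL n)%:R.
Let atom (k : nat) : set T := X @^-1` [set k%:R].

Let m_atom (k : nat) : measurable (atom k).
Proof. exact: measurable_sfunP. Qed.

Let P_atom (k : nat) : (k <= n)%N -> P (atom k) = ((ell n k)%:R / S)%:E.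
Proof.
move=> kn; rewrite -(XL kn) /pmf fineK// fin_num_measure//.
Qed.

Lemma scrL_gt0 : 0 < S.
Proof.
rewrite ltr0n /scrL big_nat_recr//= addn_gt0; apply/orP; right.
by rewrite /ell subnn muln0 binn bell0.
Qed.

Lemma measurable_deviation (c x : R) : measurable [set t | x <= `|X t - c|].
Proof.
have -> : [set t | x <= `|X t - c|] = (fun t => `|X t - c|) @^-1` `[x, +oo[.
  by apply/seteqP; split => t /=; rewrite in_itv/= andbT.
rewrite -[_ @^-1` _]setTI; apply: measurableT_comp => //.
exact: measurable_funB.
Qed.

Lemma law_L_ge (c x : R) (k : nat) : (k <= n)%N -> x <= `|k%:R - c| ->
  (((ell n k)%:R / S)%:E <= P [set t | (x <= `|X t - c|)%R])%E.
Proof.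
move=> kn xk; rewrite -P_atom//; apply: le_measure; rewrite ?inE.
- exact: m_atom.
- exact: measurable_deviation.
- by move=> t /= ->.
Qed.

(** The event lies in the complement of the atoms [k <= n] that are closer than [x] to [c]. Their
    mass is known, and the masses over all [k <= n] add up to 1. *)
Lemma law_L_le (c x : R) :
  (P [set t | (x <= `|X t - c|)%R] <=
   ((\sum_(0 <= k < n.+1 | (x <= `|k%:R - c|)%R) (ell n k)%:R)%R / S)%:E)%E.
Proof.
pose B := \big[setU/set0]_(k < n.+1 | ~~ (x <= `|k%:R - c|)) atom k.
have mB : measurable B by exact: bigsetU_measurable.
have tA : trivIset setT (fun k : 'I_n.+1 => atom k).
  apply/trivIsetP => i j _ _ ij; apply/seteqP; split => // t [/= Xi Xj].
  move/eqP: Xj; rewrite Xi eqr_nat => /eqP/val_inj/eqP.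
  by rewrite (negbTE ij).
have PB : P B = ((\sum_(0 <= k < n.+1 | ~~ (x <= `|k%:R - c|)) (ell n k)%:R) / S)%:E.
  rewrite /B measure_bigsetU_ord//= big_mkord mulr_suml -sumEFin.
  by apply: eq_bigr => k _; rewrite P_atom// -ltnS.
apply: (@le_trans _ _ (P (~` B))).
  apply: le_measure; rewrite ?inE; [exact: measurable_deviation|exact: measurableC|].
  move=> t /= xt; rewrite /B.
  apply: (big_ind (fun Y : set T => ~ Y t)) => [//|Y Z nY nZ [/nY|/nZ]//|k].
  by move=> + /= tk; rewrite -tk xt.
rewrite probability_setC// PB -EFinB lee_fin.
rewrite lerBlDr -mulrDl ler_pdivlMr ?scrL_gt0// mul1r.
by rewrite /S /scrL natr_sum (bigID (fun k : nat => x <= `|k%:R - c|)).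
Qed.

End LawL.

(* The lower bound is required for every x for which the event can occur at
   all: X is supported on {0, ..., n}, so that |X - mu| never exceeds n - mu. *)
Theorem theorem2 (R : realType) :
  \forall n \near \oo,
    forall (d : measure_display) (T : measurableType d) (P : probability T R)
           (X : {RV P >-> R}),
      has_law_L X n ->
      forall x : R, 1 < x ->
        (x <= n%:R - mu R n ->
           ((2 `^ (- (x + 1) ^+ 2 - 1))%:E
              <= P [set t | (x <= `|X t - mu R n|)%R])%E)
        /\
        (P [set t | (x <= `|X t - mu R n|)%R]
           <= (2 `^ (- (x - 2) ^+ 2 + 2) + n%:R ^- n)%:E)%E.
Proof.
near=> n => d T P X XL x x1.
have Ln : large (ln n%:R : R) by near: n; exact: large_ln.
have S0 : 0 < (scrL n)%:R :> R := scrL_gt0 R n.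
have mu0 : 0 <= mu R n.
  by apply: le_trans (mu_lb Ln); rewrite mulr_ge0// divr_ge0.
have ceilP (y : R) : 0 < y -> exists k : nat, y <= k%:R /\ k%:R < y + 1.
  move=> y0; have /andP[c1 c2] := Num.Theory.ceil_itv y.
  exists (`|Num.ceil y|)%N.
  have -> : (`|Num.ceil y|%N)%:R = (Num.ceil y)%:~R :> R.
    rewrite natr_absz ger0_norm// -(ler_int R) ltW// ?(lt_le_trans y0)//.
  by split => //; move: c1; rewrite intrB ltrBlDr.
have mu_gt0 : 0 < mu R n.
  by apply: lt_le_trans (mu_lb Ln); rewrite mulr_gt0 ?divr_gt0// (large_n_gt0 Ln).
have [k0 [k01 k02]] := ceilP _ mu_gt0.
split=> [xn|].
  have [|k1 [k11 k12]] := ceilP (mu R n + x); first by rewrite addr_gt0// (lt_trans _ x1).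
  have k1n : (k1 <= n)%N.
    by rewrite -ltnS -(ltr_nat R) -natr1 (lt_le_trans k12)// lerD2r -lerBrDl.
  apply: le_trans (law_L_ge XL k1n _); last first.
    by apply: le_trans (ler_norm _); rewrite lerBrDl.
  by rewrite lee_fin ler_pdivlMr//; apply: (ell_lb Ln k01 k02).
have [x2|x2] := leP 2 x.
  apply: (le_trans (law_L_le XL _ _)); rewrite lee_fin.
  rewrite ler_wpDr ?invr_ge0 ?exprn_ge0// ler_pdivrMr//.
  exact: (sum_ell_tail Ln k01 k02).
(* For [1 < x < 2] the exponent [2 - (x - 2) ^ 2] is positive, so the bound exceeds 1. *)
apply: (@le_trans _ _ 1%E).
  exact/probability_le1/measurable_deviation.
rewrite lee_fin ler_wpDr ?invr_ge0 ?exprn_ge0//.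
by rewrite -[leLHS](powRr0 2) ler_pow2//; nra.
Unshelve. all: by end_near. Qed.
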